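(* In the setup described in the context, let $\mathfrak C(\sigma)$ be an irreducible component of $\mathrm{GRASS}(\sigma)$, and let $f_1,\dots,f_s\in K[X]$ be polynomials whose common zero locus in $\mathbb A^{N_0}$ is the image of $\mathfrak C(\sigma)$ under $C\mapsto(c_{ij})$. Then $\mathfrak C(\sigma)=\overline{\mathfrak C(\sigma)}\cap\mathrm{SCHUBERT}(\sigma)$ (closure in $\mathbb P(\Lambda^a\mathbf P)$), viewed inside $\mathbb A^{N_1}$ via the identification of $\mathrm{SCHUBERT}(\sigma)$ with $\operatorname{Gr}(a,\mathbf P)\cap\{Y_{d+1,\dots,d+a}=1\}$, is exactly the common zero locus in $\mathbb A^{N_1}$ of the polynomials $Y_{d+1,\dots,d+a}-1$, $\;Y_{i_1,\dots,i_a}-\rho_{i_1,\dots,i_a}\big((\varepsilon_{ij}\hat Y_{ij})_{(i,j)\in N_0}\big)$ for $(i_1,\dots,i_a)\in N_1$, and $\;f_m\big((\varepsilon_{ij}\hat Y_{ij})_{(i,j)\in N_0}\big)$ for $1\le m\le s$.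
   Context: $K$ algebraically closed, $A=KQ/I$ basic finite-dimensional, $Q$ a finite quiver with vertices $e_1,\dots,e_n$, $J$ the Jacobson radical, $L+1$ the Loewy length; paths compose right to left. For $\mathbf d=(d_1,\dots,d_n)$, $d=\sum d_i$, $\mathbf P=\bigoplus_{r=1}^dAz_r$ is a projective cover of $\bigoplus_iS_i^{d_i}$ with top elements $z_r$ normed by vertices $e(r)$, $\widehat{\mathbf P}=\bigoplus_rKQz_r$, $a=\dim\mathbf P-d$; $\operatorname{Gr}(a,\mathbf P)\subseteq\mathbb P(\Lambda^a\mathbf P)$ via Plücker. A skeleton in $\widehat{\mathbf P}$ with radical layering $\mathbb S=(\mathbb S_0,\dots,\mathbb S_L)$, $\mathbb S_l=\bigoplus_iS_i^{m(l,i)}$, is a set $\sigma$ of paths $pz_r$ of length $\le L$ with exactly $m(l,i)$ paths of length $l$ ending in $e_i$, closed under initial subpaths. $\mathrm{GRASS}(\sigma)$ is the set of $A$-submodules $C\subseteq\mathbf P$ with $\underline{\dim}(\mathbf P/C)=\mathbf d$, radical layering of $\mathbf P/C$ equal to $\mathbb S$, such that the images of the paths of $\sigma$ form a basis of $\mathbf P/C$; assume $\mathrm{GRASS}(\sigma)\neq\varnothing$, so $\sigma$ is identified with a linearly independent subset $\{b_1,\dots,b_d\}$ of $\mathbf P$. $\mathrm{SCHUBERT}(\sigma)=\{C\in\operatorname{Gr}(a,\mathbf P):\mathbf P=(\bigoplus_jKb_j)\oplus C\}$. A path $b'$ of length $\le L$ is $\sigma$-critical if $b'\notin\sigma$ and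 all its proper initial subpaths lie in $\sigma$; $\sigma(b')=\{b\in\sigma:\operatorname{length}(b)\ge\operatorname{length}(b'),\ \operatorname{end}(b)=\operatorname{end}(b')\}$. Choose $\sigma$-critical paths $b'_1,\dots,b'_u$ inducing a basis of $(\sum_{b'\ \sigma\text{-critical}}Kb'+\sum_jKb_j)/\sum_jKb_j$, and paths $b''_1,\dots,b''_v$ such that $B=(b_1,\dots,b_d,b'_1,\dots,b'_u,b''_1,\dots,b''_v)=(w_1,\dots,w_{\dim\mathbf P})$ is an ordered basis of $\mathbf P$ ($u+v=a$). $N_0=\{(i,j): 1\le i\le u,\ 1\le j\le d,\ b_j\in\sigma(b'_i)\}$, $N_1=\{(i_1,\dots,i_a):1\le i_1<\dots<i_a\le\dim\mathbf P\}$; $\mathbb P(\Lambda^a\mathbf P)$ has homogeneous coordinates $Y_{i_1,\dots,i_a}$ ($(i_1,\dots,i_a)\in N_1$) with respect to the basis $w_{i_1}\wedge\cdots\wedge w_{i_a}$, and $\hat Y_{kl}:=Y_{l,d+1,\dots,d+k-1,d+k+1,\dots,\dim\mathbf P}$ for $(k,l)\in N_0$ (coordinate of $b_l\wedge b'_1\wedge\cdots\widehat{b'_k}\cdots\wedge b'_u\wedge b''_1\wedge\cdots\wedge b''_v$). Every $C\in\mathrm{GRASS}(\sigma)$ is uniquely $C=\sum_{i=1}^uA(b'_i-\sum_{(i,j)\in N_0}c_{ij}b_j)$, with coordinates $(c_{ij})\in\mathbb A^{N_0}$. The polynomials $\rho_{i_1,\dots,i_a}\in K[X_{ij}\mid(i,j)\in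 N_0]$ and signs $\varepsilon_{kl}\in\{\pm1\}$ are those with: every $C\in\mathrm{GRASS}(\sigma)$ with coordinates $(c_{ij})$ is represented in $\Lambda^a\mathbf P$ by $\sum_{N_1}\rho_{i_1,\dots,i_a}(c_{ij})w_{i_1}\wedge\cdots\wedge w_{i_a}$ (namely the wedge of $b'_i-\sum_jc_{ij}b_j$, $1\le i\le u$, and of the unique elements $b''_k-\sum_l q_{kl}b_l\in C$, $1\le k\le v$, expanded in the basis), with $\rho_{d+1,\dots,d+a}=1$ and $\rho_{l,d+1,\dots,\widehat{d+k},\dots,\dim\mathbf P}=\varepsilon_{kl}X_{kl}$ for $(k,l)\in N_0$. *)

(* Defs.v *)
From HB Require Import structures.
From mathcomp Require Import all_boot all_order all_algebra all_field.
From mathcomp Require Import mpoly.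
Set Implicit Arguments.
Unset Strict Implicit.
Unset Printing Implicit Defensive.
Import GRing.Theory.
Local Open Scope ring_scope.

(* A path is a starting vertex s and the list of its arrows IN THE     *)
(* ORDER IN WHICH THEY ARE TRAVERSED [:: a1; ...; al]; since paths are  *)
(* composed right to left, it denotes the path al ... a1 e_s.          *)
Section Quiver.
Variables (n : nat) (Ar : finType) (src tgt : Ar -> 'I_n).

Fixpoint pathFrom (s : 'I_n) (p : seq Ar) : bool :=
  if p is a :: p' then (src a == s) && pathFrom (tgt a) p' else true.

Fixpoint pend (s : 'I_n) (p : seq Ar) : 'I_n :=
  if p is a :: p' then pend (tgt a) p' else s.

Definition allseqs (l : nat) : seq (seq Ar) := [seq val t | t : l.-tuple Ar].

End Quiver.

(* The algebra A = KQ/I, given by the images ev i of the vertices and   *)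
(* ar a of the arrows in a finite dimensional K-algebra A.             *)
Section Algebra.
Variables (K : fieldType) (n : nat) (Ar : finType) (src tgt : Ar -> 'I_n).
Variables (A : falgType K) (ev : 'I_n -> A) (ar : Ar -> A) (L : nat).

Definition pathA (s : 'I_n) (p : seq Ar) : A :=
  foldl (fun acc a => ar a * acc) (ev s) p.

Definition pathsA (lo : nat) : seq A :=
  [seq pathA sp.1 sp.2 | sp <- [seq sp <- [seq (s, p) | s <- enum 'I_n,
        p <- flatten [seq allseqs Ar l | l <- iota lo (L.+1 - lo)]]
     | pathFrom src tgt sp.1 sp.2]].

(* A = KQ/I with I admissible, and the Loewy length of A is L+1:
   - the ev i are a complete set of orthogonal idempotents and
     ar a = e_{tgt a} ar a e_{src a}  (so KQ -> A is an algebra map);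
   - KQ -> A is onto (A is spanned by the images of paths, those of
     length > L being 0);
   - J^{L+1} = 0 (paths of length L+1 map to 0), i.e. J_Q^{L+1} <= I;
   - I <= J_Q^2 (images of vertices and arrows are linearly independent
     modulo the span of the images of paths of length >= 2);
   - J^L <> 0 (Loewy length exactly L+1). *)
Definition quiver_presentation : Prop :=
  [/\ (forall i, ev i * ev i = ev i),
      (forall i j, i != j -> ev i * ev j = 0),
      \sum_i ev i = 1,
      (forall a, ar a = ev (tgt a) * ar a * ev (src a)) &
      [/\ (fullv = <<pathsA 0>>)%VS,
          (forall s p, pathFrom src tgt s p -> size p = L.+1 -> pathA s p = 0),
          free ([seq ev i | i <- enum 'I_n] ++ [seq ar a | a <- enum Ar]),
          (<<[seq ev i | i <- enum 'I_n] ++ [seq ar a | a <- enum Ar]>>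
              :&: <<pathsA 2>> = 0)%VS &
          (exists s p, [/\ pathFrom src tgt s p, size p = L & pathA s p != 0])]].

(* The projective module P = (+)_{r<d} A z_r, z_r normed by e(r),       *)
(* realised as the subspace of {ffun 'I_d -> A} whose r-th component    *)
(* lies in A e(r).                                                      *)
Variables (d : nat) (e : 'I_d -> 'I_n).

Definition Pamb := {ffun 'I_d -> A}.

Definition act (x : A) (y : Pamb) : Pamb := [ffun r => x * y r].

Definition single (r : 'I_d) (x : A) : Pamb :=
  [ffun r' => if r' == r then x else 0].

Definition Pspace : {vspace Pamb} :=
  <<[seq single r (x * ev (e r))%R | r <- enum 'I_d, x <- vbasis {: A}]>>%VS.

Definition dvec (i : 'I_n) : nat := #|[set r | e r == i]|.

(* elements p z_r of hat P: pairs (r, p) *)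
Definition zpath := ('I_d * seq Ar)%type.

Definition zvalid (x : zpath) : bool := pathFrom src tgt (e x.1) x.2.
Definition zlen (x : zpath) : nat := size x.2.
Definition zend (x : zpath) : 'I_n := pend tgt (e x.1) x.2.

Definition zimg (x : zpath) : Pamb := single x.1 (pathA (e x.1) x.2).

Definition allpaths : seq zpath :=
  [seq x <- [seq (r, p) | r <- enum 'I_d,
                          p <- flatten [seq allseqs Ar l | l <- iota 0 L.+1]]
   | zvalid x].

Definition JP (l : nat) : {vspace Pamb} :=
  <<[seq zimg x | x <- allpaths & (l <= zlen x)%N]>>%VS.

Definition eP (i : 'I_n) (U : {vspace Pamb}) : {vspace Pamb} :=
  <<[seq act (ev i) y | y <- vbasis U]>>%VS.

Definition gen (ys : seq Pamb) : {vspace Pamb} :=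
  <<[seq act x y | x <- vbasis {: A}, y <- ys]>>%VS.

Definition submodule (C : {vspace Pamb}) : Prop :=
  (C <= Pspace)%VS /\ forall (x : A) (y : Pamb), y \in C -> act x y \in C.

(* Skeletons.  sigma = {sig j | j < d} (listed injectively).            *)
(* m l i = multiplicity of S_i in the l-th radical layer S_l.           *)
Variables (m : 'I_L.+1 -> 'I_n -> nat) (sig : 'I_d -> zpath).

Definition skeleton : Prop :=
  [/\ injective sig,
      (forall j, zvalid (sig j) /\ (zlen (sig j) <= L)%N),
      (forall j k, (k <= zlen (sig j))%N ->
         exists j', sig j' = ((sig j).1, take k (sig j).2)) &
      (forall (l : 'I_L.+1) (i : 'I_n),
         #|[set j | (zlen (sig j) == l) && (zend (sig j) == i)]| = m l i)].

Definition bvec (j : 'I_d) : Pamb := zimg (sig j).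
Definition sigspan : {vspace Pamb} := <<[seq bvec j | j <- enum 'I_d]>>%VS.

(* GRASS(sigma):  P/C has dimension vector d, radical layering S
   (dim e_i J^l(P/C)/J^{l+1}(P/C) = m l i), and the images of sigma form a
   basis of P/C. *)
Definition GRASS (C : {vspace Pamb}) : Prop :=
  [/\ submodule C,
      (forall i, (\dim (eP i Pspace + C) - \dim C)%N = dvec i),
      (forall (l : 'I_L.+1) i,
         (\dim (eP i (JP l) + C) - \dim (eP i (JP l.+1) + C))%N = m l i),
      free [seq bvec j | j <- enum 'I_d] &
      (sigspan :&: C = 0)%VS /\ (sigspan + C = Pspace)%VS].

Definition critical (x : zpath) : bool :=
  [&& zvalid x, (zlen x <= L)%N, x \notin codom sig &
      all (fun k => (x.1, take k x.2) \in codom sig) (iota 0 (zlen x))].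

Variables (u v : nat) (sigp : 'I_u -> zpath) (sigpp : 'I_v -> zpath).

Definition bp (i : 'I_u) : Pamb := zimg (sigp i).
Definition bpp (k : 'I_v) : Pamb := zimg (sigpp k).

Local Notation D := (d + (u + v))%N.
Local Notation a := (u + v)%N.

Definition Bf (k : 'I_D) : Pamb :=
  match split k with
  | inl j => bvec j
  | inr k' => match split k' with inl i => bp i | inr l => bpp l end
  end.

Definition Bt : D.-tuple Pamb := [tuple Bf k | k < D].

Definition basis_choice : Prop :=
  [/\ (forall i, critical (sigp i)),
      free ([seq bvec j | j <- enum 'I_d] ++ [seq bp i | i <- enum 'I_u]),
      (<<[seq bvec j | j <- enum 'I_d] ++ [seq bp i | i <- enum 'I_u]>> =
       <<[seq bvec j | j <- enum 'I_d] ++ [seq zimg x | x <- allpaths & critical x]>>)%VS,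
      (forall k, zvalid (sigpp k)) &
      free Bt /\ (<<Bt>> = Pspace)%VS].

Definition N0 : {set 'I_u * 'I_d} :=
  [set ij | (zlen (sigp ij.1) <= zlen (sig ij.2))%N && (zend (sig ij.2) == zend (sigp ij.1))].

Definition n0 : nat := #|N0|.

(* coordinates: C = sum_i A (b'_i - sum_{(i,j) in N0} c_ij b_j);
   the point of A^{N_0} is x : 'I_n0 -> K, x t = c_(enum_val t) *)
Definition ycoord (x : 'I_n0 -> K) (i : 'I_u) : Pamb :=
  bp i - \sum_(t < n0 | (enum_val t : 'I_u * 'I_d).1 == i)
           x t *: bvec (enum_val t : 'I_u * 'I_d).2.

Definition coords (C : {vspace Pamb}) (x : 'I_n0 -> K) : Prop :=
  C = gen [seq ycoord x i | i <- enum 'I_u].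

(* N_1 = a-subsets {i_1 < ... < i_a} of {0..D-1} *)
Definition N1 := {S : {set 'I_D} | #|S| == a}.

(* k-th smallest element of S *)
Definition sidx (S : N1) (k : 'I_a) : 'I_D :=
  enum_val (cast_ord (esym (eqP (valP S))) k).

(* coordinate Y_{i_1..i_a} of the wedge of the rows of M *)
Definition minor (M : 'M[K]_(a, D)) (S : N1) : K :=
  \det (\matrix_(i < a, j < a) M i (sidx S j)).

(* Y_T for a set T (0 if T is not in N_1) *)
Definition Yat (Y : N1 -> K) (T : {set 'I_D}) : K := oapp Y 0 (insub T).

(* {d+1, ..., d+a} (0-based: {d, ..., D-1}) *)
Definition topset : {set 'I_D} := [set k : 'I_D | (d <= k)%N].

Definition Shat (ij : 'I_u * 'I_d) : {set 'I_D} :=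
  lshift a ij.2 |: (topset :\ rshift d (lshift v ij.1)).

Definition plmat (C : {vspace Pamb}) : 'M[K]_(a, D) :=
  \matrix_(k < a, j < D) coord Bt j (vbasis C)`_k.

Definition pl (C : {vspace Pamb}) (S : N1) : K := minor (plmat C) S.

(* point of A^{N_1} attached to C in SCHUBERT(sigma) (Y_{d+1..d+a} = 1) *)
Definition npl (C : {vspace Pamb}) (S : N1) : K := pl C S / Yat (pl C) topset.

Definition Grass (C : {vspace Pamb}) : Prop :=
  (C <= Pspace)%VS /\ \dim C = a.

Definition SCHUBERT (C : {vspace Pamb}) : Prop :=
  Grass C /\ (sigspan + C = Pspace)%VS /\ (sigspan :&: C = 0)%VS.

Definition n1 : nat := #|{: N1}|.

Definition plvec (C : {vspace Pamb}) : 'I_n1 -> K := fun t => pl C (enum_val t).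

Definition homogeneous (g : {mpoly K[n1]}) : Prop :=
  exists k, forall mo, mo \in msupp g -> mdeg mo = k.

Definition homset (G : {mpoly K[n1]} -> Prop) : Prop :=
  forall g, G g -> homogeneous g.

Definition Vh (G : {mpoly K[n1]} -> Prop) (C : {vspace Pamb}) : Prop :=
  forall g, G g -> g.@[plvec C] = 0.

Definition irreducible (Z : {vspace Pamb} -> Prop) : Prop :=
  (exists C, Z C) /\
  forall G1 G2, homset G1 -> homset G2 ->
    (forall C, Z C -> Vh G1 C \/ Vh G2 C) ->
    (forall C, Z C -> Vh G1 C) \/ (forall C, Z C -> Vh G2 C).

Definition irr_component (X Z : {vspace Pamb} -> Prop) : Prop :=
  [/\ (forall C, Z C -> X C), irreducible Z &
      forall Z', (forall C, Z' C -> X C) -> irreducible Z' ->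
        (forall C, Z C -> Z' C) -> forall C, Z' C -> Z C].

Definition inClosure (Z : {vspace Pamb} -> Prop) (C : {vspace Pamb}) : Prop :=
  forall g : {mpoly K[n1]}, homogeneous g ->
    (forall C', Z C' -> g.@[plvec C'] = 0) -> g.@[plvec C] = 0.

Definition epsYhat (eps : 'I_u -> 'I_d -> K) (Y : N1 -> K) : 'I_n0 -> K :=
  fun t => eps (enum_val t : 'I_u * 'I_d).1 (enum_val t : 'I_u * 'I_d).2
           * Yat Y (Shat (enum_val t)).

End Algebra.

(* Main.v *)
(* On the chart Y_top = 1 the Plucker coordinates of a point of GRASS(sigma)
   with coordinates x are the rho_S(x), and x itself is read off from the
   coordinates eps_ij Yhat_ij; hence points of the component and solutions of
   the given equations determine each other.  Three facts make this work.
   - Every C in GRASS(sigma) has coordinates: comparing dimensions along the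
     radical layering shows that e_i J^l P + C is spanned modulo C by the b_j of
     length >= l ending in e_i, so each b'_i - sum_j c_ij b_j lies in C for
     suitable c_ij; the submodule they generate, plus the span of sigma, is
     stable under the arrows, so it is P, and the modular law gives C.
   - A point of SCHUBERT(sigma) is determined by its normalized Plucker
     coordinates, by Cramer's rule.
   - Homogenizing with respect to Y_top turns the equations of the chart into
     homogeneous ones, so they pass to the closure of the component. *)
Require Import Defs.
From HB Require Import structures.
From mathcomp Require Import all_boot all_order all_algebra all_field.
From mathcomp Require Import mpoly.
From mathcomp Require Import perm.
Set Implicit Arguments.
Unset Strict Implicit.
Unset Printing Implicit Defensive.
Import GRing.Theory.
Local Open Scope ring_scope.

(** Each monomial of [h] is padded with a power of the variable [t0] up to degree [msize h], which
    exceeds all degrees in the support. *)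
Lemma homogenization (K : fieldType) (n : nat) (t0 : 'I_n) (h : {mpoly K[n]}) :
  exists k (G : {mpoly K[n]}), G \is k.-homog /\
    forall y : 'I_n -> K, y t0 != 0 ->
      G.@[y] = y t0 ^+ k * h.@[fun i => y i / y t0].
Proof.
exists (msize h).
exists (\sum_(m <- msupp h) h@_m *: ('X_[m] * 'X_t0 ^+ (msize h - mdeg m))).
split.
  rewrite big_seq; apply: rpred_sum => m hm; apply: rpredZ.
  have -> : msize h = (mdeg m + (msize h - mdeg m))%N.
    by rewrite subnKC // ltnW // msize_mdeg_lt.
  apply: dhomogM; first by rewrite dhomogX.
  rewrite addKn mpolyXn dhomogX.
  by apply/eqP; rewrite /= mdegMn mdeg1 mul1n.
move=> y y0; rewrite raddf_sum /= mevalE mulr_sumr big_seq [RHS]big_seq.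
apply: eq_bigr => m hm.
rewrite mevalZ mevalM mevalX rmorphXn /= mevalXU [RHS]mulrCA; congr (_ * _).
have mh : (mdeg m <= msize h)%N by rewrite ltnW // msize_mdeg_lt.
under [in RHS]eq_bigr do rewrite exprMn exprVn.
rewrite big_split /= mulrCA; congr (_ * _).
(* The denominators collect to [y t0 ^+ mdeg m], which cancels part of [y t0 ^+ msize h]. *)
rewrite prodfV prodrXr -mdegE -[in RHS](subnK mh) exprD.
by rewrite mulfK // expf_neq0.
Qed.

(** * Maximal minors and Cramer's rule *)

Section Minors.

Variables (K : fieldType) (d u v : nat).
Local Notation a := (u + v)%N.
Local Notation D := (d + (u + v))%N.

Lemma minorE (M : 'M[K]_(a, D)) (S : N1 d u v) :
  minor M S = \det (colsub (sidx S) M).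
Proof. by congr (\det _); apply/matrixP => i j; rewrite !mxE. Qed.

Lemma sidx_onto (S : N1 d u v) x : x \in val S -> exists k, sidx S k = x.
Proof.
move=> xS; exists (cast_ord (eqP (valP S)) (enum_rank_in xS x)).
by rewrite /sidx cast_ordK enum_rankK_in.
Qed.

Lemma imset_card_N1 {g : 'I_a -> 'I_D} : injective g ->
  #|[set g i | i in 'I_a]| == a.
Proof. by move=> gI; rewrite card_imset // card_ord. Qed.

(** The sign comes from sorting the values of [g], so one [s] serves every matrix [M]. *)
Lemma det_colsub_minor (g : 'I_a -> 'I_D) (gI : injective g) :
  exists s : {perm 'I_a}, forall M : 'M[K]_(a, D),
    \det (colsub g M) =
    (-1) ^+ s * minor M (exist _ [set g i | i in 'I_a] (imset_card_N1 gI)).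
Proof.
set S := exist _ _ _.
have /fin_all_exists[f fE] : forall j, exists k, sidx S k = g j.
  by move=> j; apply: sidx_onto; apply: imset_f.
have fI : injective f by move=> i j ij; apply/gI; rewrite -!fE ij.
exists (perm fI) => M; rewrite minorE.
have -> : colsub g M = col_perm (perm fI) (colsub (sidx S) M).
  by apply/matrixP => i j; rewrite !mxE permE fE.
by rewrite col_permE det_mulmx det_perm odd_permV mulrC.
Qed.

(** A repeated column makes both determinants vanish; otherwise both acquire the same sorting
    sign. *)
Lemma det_colsub_proportional (M M' : 'M[K]_(a, D)) (c : K) :
  (forall S, minor M' S = c * minor M S) ->
  forall g : 'I_a -> 'I_D, \det (colsub g M') = c * \det (colsub g M).
Proof.
move=> MM' g; have [/injectiveP gI | ] := boolP (injectiveb g).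
  by have [s sE] := det_colsub_minor gI; rewrite !sE MM' mulrCA.
move=> /injectivePn[i [j ij gij]].
have det0 N : \det (colsub g N) = 0 :> K.
  rewrite -det_tr; apply: (determinant_alternate ij) => k.
  by rewrite !mxE gij.
by rewrite !det0 mulr0.
Qed.

(* Cramer's rule: these entries are maximal minors of M up to sign. *)
Lemma mul_adj_colsub (M : 'M[K]_(a, D)) (r : 'I_a -> 'I_D) k j :
  (\adj (colsub r M) *m M) k j =
  \det (colsub (fun i => if i == k then j else r i) M).
Proof.
rewrite (expand_det_col _ k) mxE; apply: eq_bigr => i _.
rewrite !mxE eqxx mulrC; congr (_ * (_ * \det _)).
by apply/matrixP => p q; rewrite !mxE eq_sym (negbTE (neq_lift _ _)).
Qed.

(** By [mul_adj_colsub] the two products of adjugate and matrix are proportional; multiplying by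
    [colsub r M'] turns the one for [M'] into a nonzero multiple of [M']. *)
Lemma proportional_minors_mulmx (M M' : 'M[K]_(a, D)) (c : K)
    (r : 'I_a -> 'I_D) :
  \det (colsub r M') != 0 -> (forall S, minor M' S = c * minor M S) ->
  exists T, M' = T *m M.
Proof.
move=> M'0 /det_colsub_proportional MM'.
have adjE : \adj (colsub r M') *m M' = c *: (\adj (colsub r M) *m M).
  apply/matrixP => k j.
  by rewrite [RHS]mxE !mul_adj_colsub MM'.
exists ((\det (colsub r M'))^-1 *: (c *: (colsub r M' *m \adj (colsub r M)))).
rewrite -!scalemxAl -mulmxA scalemxAr -adjE mulmxA mul_mx_adj.
by rewrite mul_scalar_mx scalerA mulVf // scale1r.
Qed.

Lemma rshift_topset : [set @rshift d a i | i in 'I_a] = topset d u v.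
Proof.
apply/setP => k; rewrite inE; apply/imsetP/idP => [[i _ ->]|dk].
  by rewrite /= leq_addr.
have kd : (k - d < a)%N by rewrite ltn_subLR ?ltn_ord.
by exists (Ordinal kd) => //; apply: val_inj; rewrite /= subnKC.
Qed.

Lemma card_topset : #|topset d u v| == a.
Proof. by rewrite -rshift_topset card_imset ?card_ord //; exact: rshift_inj. Qed.

Lemma card_Shat (ij : 'I_u * 'I_d) : #|Shat v ij| == a.
Proof.
rewrite /Shat cardsU1 !inE negb_and /=.
rewrite -ltnNge ltn_ord orbT add1n.
have := cardsD1 (rshift d (lshift v ij.1)) (topset d u v).
by rewrite (eqP card_topset) inE /= leq_addr add1n => <-.
Qed.

Lemma YatE (Y : N1 d u v -> K) (T : {set 'I_D}) (cT : #|T| == a) :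
  Yat Y T = Y (exist _ T cT).
Proof. by rewrite /Yat (insubT (fun S : {set 'I_D} => #|S| == a) cT). Qed.

Definition topN1 : N1 d u v := exist _ (topset d u v) card_topset.

Definition ShatN1 (ij : 'I_u * 'I_d) : N1 d u v :=
  exist _ (Shat v ij) (card_Shat ij).

Lemma Yat_topset (Y : N1 d u v -> K) : Yat Y (topset d u v) = Y topN1.
Proof. exact: YatE. Qed.

Lemma Yat_Shat (Y : N1 d u v -> K) ij : Yat Y (Shat v ij) = Y (ShatN1 ij).
Proof. exact: YatE. Qed.

Lemma Yat_minor_topset_neq0 (M : 'M[K]_(a, D)) :
  (Yat (minor M) (topset d u v) != 0) = (\det (colsub (@rshift d a) M) != 0).
Proof.
have [s ->] := det_colsub_minor (@rshift_inj d a).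
rewrite mulf_eq0 signr_eq0 /= Yat_topset.
by congr (minor M _ != 0); apply: val_inj; rewrite /= rshift_topset.
Qed.

End Minors.

Arguments topN1 {d u v}.
Arguments ShatN1 {d u} v ij.

(** * Coordinate matrices of subspaces *)

Section CoordinateMatrix.

Variables (K : fieldType) (vT : vectType K) (a D : nat) (B : D.-tuple vT).

(** For [B = Bt] this is [plmat]. Rows of index at least [\dim C] are 0, the default value of
    [nth]. *)
Definition coordmx (C : {vspace vT}) : 'M[K]_(a, D) :=
  \matrix_(k < a, j < D) coord B j (vbasis C)`_k.

Lemma vbasis_nth_mem (C : {vspace vT}) k : (vbasis C)`_k \in C.
Proof.
have [kC|kC] := ltnP k (\dim C); last by rewrite nth_default ?size_tuple ?mem0v.
by apply/vbasis_mem/mem_nth; rewrite size_tuple.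
Qed.

Lemma coordmx_mulmx_sub (C C' : {vspace vT}) (T : 'M[K]_a) :
  (C <= <<B>>)%VS -> (C' <= <<B>>)%VS -> \dim C' = a ->
  coordmx C' = T *m coordmx C -> (C' <= C)%VS.
Proof.
move=> CB C'B dimC' /matrixP C'E.
rewrite -(span_basis (vbasisP C')); apply/span_subvP => y /(nthP 0)[k kC' <-].
have ka : (k < a)%N by rewrite -dimC' -(size_tuple (vbasis C')).
rewrite (coord_span (subvP C'B _ (vbasis_nth_mem _ _))).
have -> : \sum_j coord B j (vbasis C')`_k *: B`_j =
          \sum_i T (Ordinal ka) i *: (vbasis C)`_i.
  transitivity (\sum_j \sum_i
      (T (Ordinal ka) i * coord B j (vbasis C)`_i) *: B`_j).
    apply: eq_bigr => j _; have := C'E (Ordinal ka) j.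
    rewrite !mxE /= => ->; rewrite scaler_suml.
    by apply: eq_bigr => i _; rewrite mxE.
  rewrite exchange_big /=; apply: eq_bigr => i _.
  rewrite [in RHS](coord_span (subvP CB _ (vbasis_nth_mem C i))) scaler_sumr.
  by apply: eq_bigr => j _; rewrite scalerA.
by apply: memv_suml => i _; apply/memvZ/vbasis_nth_mem.
Qed.

(** A left kernel vector yields an element of [C] whose coordinates at the positions [r] vanish; it
    is 0, and freeness of the basis kills the vector. *)
Lemma coordmx_det_neq0 (C : {vspace vT}) (r : 'I_a -> 'I_D) :
  \dim C = a ->
  (forall w, w \in C -> (forall k, coord B (r k) w = 0) -> w = 0) ->
  \det (colsub r (coordmx C)) != 0.
Proof.
move=> dimC C0; apply/det0P => -[w w0 /matrixP wM].
have x0 : \sum_i w 0 i *: (vbasis C)`_i = 0.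
  apply: C0 => [|k].
    by apply: memv_suml => i _; apply/memvZ/vbasis_nth_mem.
  have := wM 0 k; rewrite !mxE => wMk.
  rewrite -[RHS]wMk linear_sum /=.
  by apply: eq_bigr => i _; rewrite linearZ !mxE.
case/eqP: w0; apply/matrixP => i k; rewrite (ord1 i) mxE.
(* Once [a] is replaced by [\dim C], the sum runs over exactly the basis, as [freeP] requires. *)
move: w x0 k {wM}; case: a / dimC => w x0 k.
by have /freeP := basis_free (vbasisP C); apply.
Qed.

End CoordinateMatrix.

(** * The action of A on P and generated submodules *)

Section ModuleAction.

Variables (K : fieldType) (A : falgType K) (d : nat).
Local Notation P := (Pamb A d).

Lemma act_is_linear (x : A) : linear (@act K A d x).
Proof. by move=> c y z; apply/ffunP => r; rewrite !ffunE mulrDr -scalerAr. Qed.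

HB.instance Definition _ (x : A) :=
  GRing.isLinear.Build K P P *:%R (@act K A d x) (act_is_linear x).

Definition actr (y : P) (x : A) : P := act x y.

Lemma actr_is_linear (y : P) : linear (actr y).
Proof. by move=> c x z; apply/ffunP => r; rewrite !ffunE mulrDl -scalerAl. Qed.

HB.instance Definition _ (y : P) :=
  GRing.isLinear.Build K A P *:%R (actr y) (actr_is_linear y).

Lemma actA (x x' : A) (y : P) : act x (act x' y) = act (x * x') y.
Proof. by apply/ffunP => r; rewrite !ffunE mulrA. Qed.

Lemma act_single (x z : A) (r : 'I_d) : act x (single r z) = single r (x * z).
Proof. by apply/ffunP => r'; rewrite !ffunE; case: eqP; rewrite ?mulr0. Qed.

Lemma linear_span_sub (V W : vectType K) (f : {linear V -> W}) (X : seq V)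
    (U : {vspace W}) :
  (forall y, y \in X -> f y \in U) -> forall y, y \in <<X>>%VS -> f y \in U.
Proof.
move=> fX y yX; rewrite -(lfunE f).
have: (linfun f @: <<X>> <= U)%VS.
  rewrite limg_span; apply/span_subvP => _ /mapP[z zX ->].
  by rewrite lfunE; apply: fX.
by move/subvP; apply; apply: memv_img.
Qed.

(** [gen] multiplies by a basis of A only; linearity of [actr y] reaches every [x]. *)
Lemma mem_gen (x : A) (ys : seq P) (y : P) : y \in ys -> act x y \in gen ys.
Proof.
move=> yys.
have xA : x \in <<vbasis {: A}>>%VS by rewrite (span_basis (vbasisP _)) memvf.
apply: (linear_span_sub (f := actr y) _ xA) => b bA.
by apply/memv_span/allpairsP; exists (b, y).
Qed.

Lemma gen_act (x : A) (ys : seq P) (y : P) :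
  y \in gen ys -> act x y \in gen ys.
Proof.
apply: (linear_span_sub (f := act x)) => _ /allpairsP[[b z] /= [_ zys ->]].
by rewrite actA; apply: mem_gen.
Qed.

Lemma gen_sub (ys : seq P) (C : {vspace P}) :
  (forall x y, y \in C -> act x y \in C) -> {subset ys <= C} ->
  (gen ys <= C)%VS.
Proof.
move=> CA ysC; apply/span_subvP => _ /allpairsP[[b z] /= [_ zys ->]].
exact/CA/ysC.
Qed.

Lemma ePE (n : nat) (ev : 'I_n -> A) i (U : {vspace P}) :
  eP ev i U = (linfun (act (ev i)) @: U)%VS.
Proof.
rewrite -{2}(span_basis (vbasisP U)) limg_span; congr <<_>>%VS.
by apply: eq_map => y; rewrite lfunE.
Qed.

End ModuleAction.

Lemma mem_span_enumP (K : fieldType) (vT : vectType K) (I : finType)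
    (Q : {set I}) (F : I -> vT) (w : vT) :
  w \in <<[seq F j | j <- enum Q]>>%VS ->
  exists c : I -> K, w = \sum_(j in Q) c j *: F j.
Proof.
rewrite span_def big_map big_enum /= => /memv_sumP[vs vsF ->].
have /fin_all_exists[c cE] : forall j, exists k, j \in Q -> vs j = k *: F j.
  move=> j; have [/vsF/vlineP[k ->]|_] := boolP (j \in Q); last by exists 0.
  by exists k.
by exists c; apply: eq_bigr => j /cE.
Qed.

(** * Paths and the radical filtration of P *)

Section QuiverPaths.

Variables (K : fieldType) (n : nat) (Ar : finType) (src tgt : Ar -> 'I_n).
Variables (A : falgType K) (ev : 'I_n -> A) (ar : Ar -> A) (L : nat).
Hypothesis HA : quiver_presentation src tgt ev ar L.

Lemma pathFrom_rcons s p a :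
  pathFrom src tgt s (rcons p a) =
  pathFrom src tgt s p && (src a == pend tgt s p).
Proof. by elim: p s => [|b p IHp] s /=; rewrite ?andbT // IHp andbA. Qed.

Lemma pend_rcons s p (a : Ar) : pend tgt s (rcons p a) = tgt a.
Proof. by elim: p s => [|b p IHp] s /=. Qed.

Lemma pathA_rcons s p a : pathA ev ar s (rcons p a) = ar a * pathA ev ar s p.
Proof. by rewrite /pathA foldl_rcons. Qed.

Lemma ev_pathA s p :
  ev (pend tgt s p) * pathA ev ar s p = pathA ev ar s p.
Proof.
have [evv _ _ arE _] := HA.
elim/last_ind: p => [|p a _]; first by rewrite /= evv.
rewrite pend_rcons pathA_rcons mulrA; congr (_ * _).
by rewrite arE !mulrA evv.
Qed.

Lemma ar_pathA0 s p a : src a != pend tgt s p -> ar a * pathA ev ar s p = 0.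
Proof.
have [_ evo _ arE _] := HA => nsrc.
by rewrite arE -ev_pathA -mulrA [ev (src a) * _]mulrA evo // mul0r mulr0.
Qed.

Variables (d : nat) (e : 'I_d -> 'I_n).

Lemma mem_allpaths x :
  (x \in allpaths src tgt L e) = zvalid src tgt e x && (zlen x <= L)%N.
Proof.
rewrite mem_filter; congr (_ && _).
apply/allpairsP/idP => [[[r p] [_ /flattenP[_ /mapP[l lL ->] pl ->]]]|xL].
  move: lL pl; rewrite mem_iota add0n ltnS => lL /mapP[t _ ->].
  by rewrite /zlen /= size_tuple.
exists x; split; [by rewrite mem_enum|apply/flattenP|by case: x xL].
exists (allseqs Ar (zlen x)); last first.
  by apply/mapP; exists (in_tuple x.2); rewrite ?mem_enum.
by apply/mapP; exists (zlen x) => //; rewrite mem_iota.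
Qed.

Lemma act_ar_zimg a (x : zpath Ar d) :
  act (ar a) (zimg ev ar e x) = zimg ev ar e (x.1, rcons x.2 a).
Proof. by rewrite /zimg act_single pathA_rcons. Qed.

Lemma act_ar_zimg0 a (x : zpath Ar d) :
  src a != zend tgt e x -> act (ar a) (zimg ev ar e x) = 0.
Proof.
move=> nsrc; rewrite /zimg act_single ar_pathA0 //.
by apply/ffunP => r; rewrite !ffunE if_same.
Qed.

Lemma act_ev_zimg (x : zpath Ar d) :
  act (ev (zend tgt e x)) (zimg ev ar e x) = zimg ev ar e x.
Proof. by rewrite /zimg act_single ev_pathA. Qed.

Lemma zimg_longest0 (x : zpath Ar d) :
  zvalid src tgt e x -> zlen x = L.+1 -> zimg ev ar e x = 0.
Proof.
have [_ _ _ _ [_ long0 _ _ _]] := HA => xv xL.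
by rewrite /zimg long0 //; apply/ffunP => r; rewrite !ffunE if_same.
Qed.

Lemma JP_last : JP src tgt ev ar L e L.+1 = 0%VS.
Proof.
rewrite /JP; set s := filter _ _; suff -> : s = [::] by rewrite span_nil.
apply/eqP; rewrite -(negbK (_ == _)) -has_filter; apply/hasP => -[x].
by rewrite mem_allpaths => /andP[_ xL]; rewrite ltnNge xL.
Qed.

Lemma JP_sub l : (JP src tgt ev ar L e l.+1 <= JP src tgt ev ar L e l)%VS.
Proof.
apply: sub_span => _ /mapP[x + ->]; rewrite mem_filter => /andP[/ltnW lx xp].
by apply: map_f; rewrite mem_filter lx.
Qed.

Lemma zimg_eP_JP (x : zpath Ar d) l : zvalid src tgt e x -> (l <= zlen x <= L)%N ->
  zimg ev ar e x \in eP ev (zend tgt e x) (JP src tgt ev ar L e l).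
Proof.
move=> xv /andP[lx xL]; rewrite ePE -{1}act_ev_zimg -lfunE; apply: memv_img.
by apply/memv_span/map_f; rewrite mem_filter lx mem_allpaths xv.
Qed.

End QuiverPaths.

(** * Existence of coordinates on GRASS(sigma) *)

Section SkeletonCoordinates.

Variables (K : fieldType) (n : nat) (Ar : finType) (src tgt : Ar -> 'I_n).
Variables (A : falgType K) (ev : 'I_n -> A) (ar : Ar -> A) (L : nat).
Hypothesis HA : quiver_presentation src tgt ev ar L.
Variables (d : nat) (e : 'I_d -> 'I_n).
Variables (m : 'I_L.+1 -> 'I_n -> nat) (sig : 'I_d -> zpath Ar d).
Hypothesis Hsk : skeleton src tgt e m sig.
Variable C : {vspace Pamb A d}.
Hypothesis HC : GRASS src tgt ev ar e m sig C.

Local Notation b := (bvec ev ar e sig).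
Local Notation JP := (JP src tgt ev ar L e).

(** When [l] and [i] are the length and the end of a critical path b', this is the index set of
    sigma(b'). *)
Definition skeleton_above (l : nat) (i : 'I_n) : {set 'I_d} :=
  [set j | (l <= zlen (sig j))%N && (zend tgt e (sig j) == i)].

(** Descending induction from [l = L.+1], where [JP] is 0: each layer adds [m l i], the number of
    paths of sigma of length [l] ending in [i]. *)
Lemma dim_eP_JP l i : (l <= L.+1)%N ->
  \dim (eP ev i (JP l) + C)%VS = (#|skeleton_above l i| + \dim C)%N.
Proof.
have [_ _ layer _ _] := HC; have [_ sigL _ sigm] := Hsk.
move=> lL; rewrite -(subKn lL); elim: (L.+1 - l)%N (leq_subr l L.+1) => [_|k IHk kL].
  rewrite subn0 JP_last ePE limg0 add0v.
  rewrite (_ : skeleton_above _ _ = set0) ?cards0 //; apply/setP => j.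
  by rewrite !inE ltnNge (sigL j).2.
have lkL : (L.+1 - k.+1 < L.+1)%N by rewrite ltn_subrL.
have := layer (Ordinal lkL) i; rewrite -(sigm (Ordinal lkL)) /=.
have -> : (L.+1 - k.+1).+1 = (L.+1 - k)%N by rewrite subnSK.
set q := (L.+1 - k.+1)%N in lkL *; set q' := (L.+1 - k)%N in IHk *.
have q'E : q' = q.+1 by rewrite /q' /q subnSK.
(* The layer condition is a truncated subtraction; this inequality lets it be read as a sum. *)
have le_dim : (\dim (eP ev i (JP q') + C) <= \dim (eP ev i (JP q) + C))%N.
  by apply/dimvS/addvS; rewrite // !ePE limgS // q'E JP_sub.
move/eqP; rewrite -(eqn_add2r (\dim (eP ev i (JP q') + C)%VS)) subnK // => /eqP ->.
rewrite IHk ?(ltnW kL) // addnA; congr (_ + _)%N.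
rewrite -cardsUI (_ : _ :&: _ = set0) ?cards0 ?addn0; last first.
  by apply/setP => j; rewrite !inE q'E; case: ltngtP => //=; rewrite ?andbF.
congr #|pred_of_set _|; apply/setP => j.
by rewrite !inE q'E [(q <= _)%N]leq_eqVlt eq_sym andb_orl.
Qed.

Lemma dim_span_bvec (Q : {set 'I_d}) : \dim <<[seq b j | j <- enum Q]>> = #|Q|.
Proof.
have [_ _ _ bfree _] := HC.
have QE : enum Q = [seq j <- enum 'I_d | j \in Q].
  by rewrite enumT /enum_mem unlock.
apply/eqP; rewrite cardE -(size_map b).
apply: (@catl_free _ _ [seq b j | j <- [seq j <- enum 'I_d | j \notin Q]]).
rewrite QE -map_cat (perm_free (perm_map _ (permEl (perm_filterC _ _)))).
exact: bfree.
Qed.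

Lemma span_above_sub l i :
  (<<[seq b j | j <- enum (skeleton_above l i)]>> <= eP ev i (JP l))%VS.
Proof.
have [_ sigL _ _] := Hsk.
apply/span_subvP => _ /mapP[j + ->]; rewrite mem_enum inE => /andP[lj /eqP <-].
by have [jv jL] := sigL j; apply: zimg_eP_JP; rewrite ?lj.
Qed.

Lemma span_bvec_sub (Q : {set 'I_d}) :
  (<<[seq b j | j <- enum Q]>> <= sigspan ev ar e sig)%VS.
Proof. by apply: sub_span => _ /mapP[j _ ->]; rewrite map_f ?mem_enum. Qed.

(** The left side is contained in the right one, and the dimensions agree because sigma is
    independent modulo [C]. *)
Lemma span_above_eP l i : (l <= L.+1)%N ->
  (<<[seq b j | j <- enum (skeleton_above l i)]>> + C = eP ev i (JP l) + C)%VS.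
Proof.
have [_ _ _ _ [sC0 _]] := HC => lL.
apply/eqP; rewrite eqEdim addvS ?span_above_sub //= dim_eP_JP //.
rewrite dimv_disjoint_sum ?dim_span_bvec //.
by apply/eqP; rewrite -subv0 -sC0 capvS ?span_bvec_sub.
Qed.

Variables (u v : nat) (sigp : 'I_u -> zpath Ar d) (sigpp : 'I_v -> zpath Ar d).
Hypothesis HB : basis_choice src tgt ev ar L e sig sigp sigpp.

Local Notation n0 := (n0 tgt e sig sigp).

(** Lets [ycoord], indexed by the enumeration of [N0], be read as a sum over sigma(b'_i). *)
Lemma sum_N0 (V : zmodType) (F : 'I_u * 'I_d -> V) i :
  \sum_(t < n0 | (enum_val t : 'I_u * 'I_d).1 == i) F (enum_val t) =
  \sum_(j in skeleton_above (zlen (sigp i)) (zend tgt e (sigp i))) F (i, j).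
Proof.
rewrite -(big_enum_val_cond (fun ij : 'I_u * 'I_d => ij.1 == i)).
transitivity (\sum_(i' | i' == i) \sum_(j | (i', j) \in N0 tgt e sig sigp) F (i', j)).
  rewrite pair_big_dep /=; apply: eq_big => [[i' j]|[i' j] _] //=.
  by rewrite andbC.
by rewrite big_pred1_eq; apply: eq_bigl => j; rewrite !inE.
Qed.

Lemma exists_ycoord_mem :
  exists x : 'I_n0 -> K, forall i, ycoord ev ar x i \in C.
Proof.
have [crit _ _ _ _] := HB.
have /fin_all_exists[c cE] : forall i, exists c : 'I_d -> K,
    bp ev ar e sigp i -
    \sum_(j in skeleton_above (zlen (sigp i)) (zend tgt e (sigp i))) c j *: b j
      \in C.
  move=> i; have /and4P[iv iL _ _] := crit i.
  have : bp ev ar e sigp i \in (eP ev (zend tgt e (sigp i)) (JP (zlen (sigp i))) + C)%VS.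
    by apply: (subvP (addvSl _ _)); apply: zimg_eP_JP => //; rewrite leqnn.
  rewrite -span_above_eP ?leqW // => /memv_addP[w /mem_span_enumP[c ->] [y yC ->]].
  by exists c; rewrite addrC addKr.
exists (fun t => c (enum_val t : 'I_u * 'I_d).1 (enum_val t : 'I_u * 'I_d).2) => i.
by rewrite /ycoord (sum_N0 (fun ij => c ij.1 ij.2 *: b ij.2)).
Qed.

(** * The generated submodule and sigma together span P *)

Section GeneratedSubmodule.

Variable x : 'I_n0 -> K.
Local Notation U :=
  (gen [seq ycoord ev ar x i | i <- enum 'I_u] + sigspan ev ar e sig)%VS.

Lemma bvec_mem_gen_sigspan j : b j \in U.
Proof. by apply/(subvP (addvSr _ _))/memv_span/map_f; rewrite mem_enum. Qed.

Lemma bp_mem_gen_sigspan i : bp ev ar e sigp i \in U.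
Proof.
rewrite -[bp _ _ _ _ _](subrK (\sum_(t < n0 | (enum_val t : 'I_u * 'I_d).1 == i)
           x t *: b (enum_val t : 'I_u * 'I_d).2)).
apply: memvD; last by apply: memv_suml => t _; apply/memvZ/bvec_mem_gen_sigspan.
apply: (subvP (addvSl _ _)).
rewrite -/(ycoord ev ar x i).
have <- : act 1 (ycoord ev ar x i) = ycoord ev ar x i.
  by apply/ffunP => r; rewrite ffunE mul1r.
by apply/mem_gen/map_f; rewrite mem_enum.
Qed.

Lemma critical_mem_gen_sigspan z :
  critical src tgt L e sig z -> zimg ev ar e z \in U.
Proof.
have [_ _ spanE _ _] := HB => zc; have /and3P[zv zL _] := zc.
have : zimg ev ar e z \in
    <<[seq b j | j <- enum 'I_d] ++
      [seq zimg ev ar e y | y <- allpaths src tgt L e & critical src tgt L e sig y]>>%VS.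
  apply: memv_span; rewrite mem_cat map_f ?orbT // mem_filter zc.
  by rewrite mem_allpaths zv.
rewrite -spanE; apply/subvP/span_subvP => y; rewrite mem_cat.
by case/orP=> /mapP[k _ ->]; [exact: bvec_mem_gen_sigspan|exact: bp_mem_gen_sigspan].
Qed.

(* An arrow prolongs a path of sigma to a path of sigma, a critical path, or 0. *)
Lemma act_ar_gen_sigspan a y : y \in U -> act (ar a) y \in U.
Proof.
have [_ sigL sigcl _] := Hsk.
case/memv_addP=> y1 y1g [y2 y2s ->]; rewrite linearD; apply: memvD.
  by apply: (subvP (addvSl _ _)); apply: gen_act.
apply: (linear_span_sub _ y2s) => _ /mapP[j _ ->] /=.
have [jv jL] := sigL j.
have [srcE|nsrc] := eqVneq (src a) (zend tgt e (sig j)); last first.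
  by rewrite (act_ar_zimg0 HA) ?mem0v.
rewrite act_ar_zimg; set z := (_, _).
have zv : zvalid src tgt e z by rewrite /zvalid pathFrom_rcons srcE eqxx andbT.
have zlenE : zlen z = (zlen (sig j)).+1 by rewrite /zlen size_rcons.
have [zL|Lz] := leqP (zlen z) L; last first.
  by rewrite (zimg_longest0 HA) ?mem0v //; apply/eqP; rewrite eqn_leq Lz zlenE ltnS jL.
have [/codomP[j' ->]|zs] := boolP (z \in codom sig).
  exact: bvec_mem_gen_sigspan.
(* The proper initial subpaths of [z] are initial subpaths of [sig j], hence lie in sigma. *)
apply: critical_mem_gen_sigspan; apply/and4P; split=> //; apply/allP => k.
rewrite mem_iota add0n zlenE ltnS => /= kj.
have [j' j'E] := sigcl j k kj.
by rewrite -cats1 takel_cat // -j'E codom_f.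
Qed.

(** Induction on the path: a trivial path outside sigma is critical, having no proper initial
    subpath, and arrows preserve the subspace. *)
Lemma zimg_mem_gen_sigspan z : zvalid src tgt e z -> zimg ev ar e z \in U.
Proof.
case: z => r p; elim/last_ind: p => [|p a IHp].
  move=> _; have [/codomP[j ->]|zs] := boolP ((r, [::]) \in codom sig).
    exact: bvec_mem_gen_sigspan.
  by apply: critical_mem_gen_sigspan; apply/and4P.
rewrite /zvalid /= pathFrom_rcons => /andP[pv _].
by rewrite -(act_ar_zimg ev ar e a (r, p)); apply/act_ar_gen_sigspan/IHp.
Qed.

Lemma Pspace_sub_gen_sigspan : (Pspace ev e <= U)%VS.
Proof.
have [_ _ _ sppv [_ <-]] := HB.
apply/span_subvP => _ /mapP[k _ ->]; rewrite /Bf.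
case: (split k) => [j|k']; first exact: bvec_mem_gen_sigspan.
case: (split k') => [i|l]; first exact: bp_mem_gen_sigspan.
exact/zimg_mem_gen_sigspan/sppv.
Qed.

End GeneratedSubmodule.

Lemma GRASS_coords : exists x : 'I_n0 -> K, coords ev ar C x.
Proof.
have [[CP Cact] _ _ _ [sC0 _]] := HC.
have [x xC] := exists_ycoord_mem; exists x.
have genC : (gen [seq ycoord ev ar x i | i <- enum 'I_u] <= C)%VS.
  by apply: gen_sub => // _ /mapP[i _ ->].
(* By the modular law, [gen + (sigspan :&: C)] equals [(gen + sigspan) :&: C], which is [C] as the
   sum contains P. *)
rewrite /coords -[RHS]addv0 -sC0 (vspace_modl _ genC); apply/esym/capv_idPr.
exact: subv_trans CP (Pspace_sub_gen_sigspan x).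
Qed.

End SkeletonCoordinates.

(** * Normalized Plücker coordinates on SCHUBERT(sigma) *)

Section Schubert.

Variables (K : fieldType) (n : nat) (Ar : finType) (src tgt : Ar -> 'I_n).
Variables (A : falgType K) (ev : 'I_n -> A) (ar : Ar -> A) (L : nat).
Variables (d : nat) (e : 'I_d -> 'I_n) (sig : 'I_d -> zpath Ar d).
Variables (u v : nat) (sigp : 'I_u -> zpath Ar d) (sigpp : 'I_v -> zpath Ar d).
Hypothesis HB : basis_choice src tgt ev ar L e sig sigp sigpp.

Local Notation Bt := (Bt ev ar e sig sigp sigpp).
Local Notation pl := (pl ev ar e sig sigp sigpp).
Local Notation npl := (npl ev ar e sig sigp sigpp).
Local Notation plvec := (plvec ev ar e sig sigp sigpp).
Local Notation SCHUBERT := (SCHUBERT ev ar e sig u v).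
Local Notation inClosure := (inClosure ev ar e sig sigp sigpp).

Lemma Bt_lshift j : Bt`_(lshift (u + v) j) = bvec ev ar e sig j.
Proof. by rewrite -tnth_nth tnth_mktuple /Bf (unsplitK (inl j)). Qed.

(** An element of [C] without b' and b'' coordinates lies in the span of sigma, which meets [C] in
    0. *)
Lemma SCHUBERT_pl_topset C : SCHUBERT C -> Yat (pl C) (topset d u v) != 0.
Proof.
have [_ _ _ _ [_ BtE]] := HB => -[[CP dimC] [_ sC0]].
rewrite Yat_minor_topset_neq0; apply: coordmx_det_neq0 => // w wC w0.
apply/eqP; rewrite -memv0 -sC0 memv_cap wC andbT.
have wB : w \in <<Bt>>%VS by rewrite BtE (subvP CP).
rewrite (coord_span wB) big_split_ord /= [X in _ + X]big1 ?addr0; last first.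
  by move=> k _; rewrite w0 scale0r.
apply: memv_suml => j _; rewrite Bt_lshift; apply/memvZ/memv_span/map_f.
by rewrite mem_enum.
Qed.

(** Proportional minors make the matrix of [C] a left multiple of that of [C'], so [C] lies in [C'];
    the dimensions agree. *)
Lemma SCHUBERT_npl_inj C C' :
  SCHUBERT C -> SCHUBERT C' -> npl C =1 npl C' -> C = C'.
Proof.
move=> SC SC' CC'; have [_ _ _ _ [_ BtE]] := HB.
have [[CP dimC] _] := SC; have [[CP' dimC'] _] := SC'.
have C0 := SCHUBERT_pl_topset SC; have C'0 := SCHUBERT_pl_topset SC'.
have plE S : pl C S =
    Yat (pl C) (topset d u v) / Yat (pl C') (topset d u v) * pl C' S.
  by rewrite -mulrA [_^-1 * _]mulrC -[_ * _^-1]/(npl C' S) -CC' mulrC divfK.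
have [T TE] : exists T, coordmx (u + v) Bt C = T *m coordmx (u + v) Bt C'.
  apply: (proportional_minors_mulmx (r := @rshift d (u + v)) _ plE).
  by rewrite -Yat_minor_topset_neq0.
apply/eqP; rewrite eqEdim dimC dimC' leqnn andbT.
by apply: coordmx_mulmx_sub TE; rewrite ?BtE.
Qed.

Lemma GRASS_SCHUBERT (m : 'I_L.+1 -> 'I_n -> nat) C :
  GRASS src tgt ev ar e m sig C -> SCHUBERT C.
Proof.
move=> [[CP _] _ _ bfree [sC0 sCP]]; split=> //; split=> //.
have [_ _ _ _ [Btfree BtE]] := HB.
have := dimv_disjoint_sum sC0; rewrite sCP -BtE (eqnP Btfree) size_tuple.
rewrite (eqnP bfree) size_map size_enum_ord.
by move=> /eqP; rewrite eqn_add2l => /eqP.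
Qed.

(** The homogenization of [h] differs from [h] on normalized coordinates by a power of the top
    coordinate, which is nonzero on SCHUBERT(sigma). *)
Lemma inClosure_npl (Z : {vspace Pamb A d} -> Prop) C
    (h : {mpoly K[n1 d u v]}) :
  (forall C', Z C' -> SCHUBERT C') -> SCHUBERT C -> inClosure Z C ->
  (forall C', Z C' -> h.@[fun t => npl C' (enum_val t)] = 0) ->
  h.@[fun t => npl C (enum_val t)] = 0.
Proof.
move=> ZS SC clC hZ.
have [k [G [Ghom GE]]] := homogenization (enum_rank topN1) h.
have plvec_top C' : plvec C' (enum_rank topN1) = Yat (pl C') (topset d u v).
  by rewrite /plvec enum_rankK Yat_topset.
have GnplE C' : SCHUBERT C' -> G.@[plvec C'] =
    Yat (pl C') (topset d u v) ^+ k * h.@[fun t => npl C' (enum_val t)].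
  move=> /SCHUBERT_pl_topset; rewrite -plvec_top => /GE ->.
  by congr (_ * _); apply: meval_eq => t; rewrite plvec_top.
have /eqP : G.@[plvec C] = 0.
  apply: clC => [|C' ZC']; last by rewrite GnplE ?hZ ?mulr0 //; apply: ZS.
  by exists k; apply/dhomogP.
by rewrite GnplE // mulf_eq0 expf_eq0 (negbTE (SCHUBERT_pl_topset SC)) andbF =>
  /eqP.
Qed.

End Schubert.

(** * Pulling polynomials back to the Plücker chart *)

Section Pullback.

Variables (K : fieldType) (n : nat) (Ar : finType) (tgt : Ar -> 'I_n).
Variables (d : nat) (e : 'I_d -> 'I_n) (sig : 'I_d -> zpath Ar d).
Variables (u v : nat) (sigp : 'I_u -> zpath Ar d) (eps : 'I_u -> 'I_d -> K).

Local Notation n0 := (n0 tgt e sig sigp).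

(** A genuine polynomial in the coordinates Y, so that [inClosure_npl] can be applied to it. *)
Definition epsYhat_comp (g : {mpoly K[n0]}) : {mpoly K[n1 d u v]} :=
  g \mPo [tuple eps (enum_val t : 'I_u * 'I_d).1 (enum_val t : 'I_u * 'I_d).2 *:
            'X_(enum_rank (ShatN1 v (enum_val t))) | t < n0].

Lemma epsYhat_compE (g : {mpoly K[n0]}) (Y : N1 d u v -> K) :
  (epsYhat_comp g).@[fun t => Y (enum_val t)] =
  g.@[@epsYhat _ _ _ tgt _ e sig u v sigp eps Y].
Proof.
rewrite comp_mpoly_meval; apply: meval_eq => t.
by rewrite tnth_mktuple mevalZ mevalXU enum_rankK /epsYhat Yat_Shat.
Qed.

End Pullback.

(** * The equations of a component and its closure *)

Theorem theorem6p4
  (K : closedFieldType)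
  (* the quiver Q *)
  (n : nat) (Ar : finType) (src tgt : Ar -> 'I_n)
  (* A = KQ/I, I admissible, Loewy length L+1 *)
  (A : falgType K) (ev : 'I_n -> A) (ar : Ar -> A) (L : nat)
  (HA : quiver_presentation src tgt ev ar L)
  (* P = (+)_{r<d} A z_r, z_r normed by e(r) *)
  (d : nat) (e : 'I_d -> 'I_n)
  (* the skeleton sigma = {b_1,...,b_d} with radical layering S *)
  (m : 'I_L.+1 -> 'I_n -> nat) (sig : 'I_d -> zpath Ar d)
  (Hsk : skeleton src tgt e m sig)
  (Hne : exists C, GRASS src tgt ev ar e m sig C)
  (* the sigma-critical b'_1..b'_u and the b''_1..b''_v *)
  (u v : nat) (sigp : 'I_u -> zpath Ar d) (sigpp : 'I_v -> zpath Ar d)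
  (HB : basis_choice src tgt ev ar L e sig sigp sigpp)
  (* the signs eps_kl and polynomials rho_{i_1..i_a} *)
  (eps : 'I_u -> 'I_d -> K)
  (rho : N1 d u v -> {mpoly K[n0 tgt e sig sigp]})
  (Heps : forall k l, eps k l = 1 \/ eps k l = -1)
  (Hrho_top : forall S : N1 d u v, val S = topset d u v -> rho S = 1)
  (Hrho_hat : forall (t : 'I_(n0 tgt e sig sigp)) (S : N1 d u v),
      val S = Shat v (enum_val t) ->
      rho S = eps (enum_val t : 'I_u * 'I_d).1 (enum_val t : 'I_u * 'I_d).2 *: 'X_t)
  (Hrho : forall C x, GRASS src tgt ev ar e m sig C ->
      @coords _ _ _ tgt _ ev ar _ e sig _ sigp C x ->
      exists2 lam : K, lam != 0 &
        forall S, (rho S).@[x] = lam * pl ev ar e sig sigp sigpp C S)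
  (* an irreducible component of GRASS(sigma) *)
  (Comp : {vspace Pamb A d} -> Prop)
  (HComp : irr_component ev ar e sig sigp sigpp
             (GRASS src tgt ev ar e m sig) Comp)
  (* f_1..f_s cutting out its image in A^{N_0} *)
  (s : nat) (f : 'I_s -> {mpoly K[n0 tgt e sig sigp]})
  (Hf : forall x : 'I_(n0 tgt e sig sigp) -> K,
      (forall k, (f k).@[x] = 0) <->
      exists C, Comp C /\ @coords _ _ _ tgt _ ev ar _ e sig _ sigp C x) :
  (* C(sigma) = closure(C(sigma)) /\ SCHUBERT(sigma) *)
  (forall C : {vspace Pamb A d},
      Comp C <-> (SCHUBERT ev ar e sig u v C /\
                  inClosure ev ar e sig sigp sigpp Comp C)) /\
  (* its image in A^{N_1} is the common zero locus of the given polynomials *)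
  (forall Y : N1 d u v -> K,
      [/\ Yat Y (topset d u v) - 1 = 0,
          (forall S, Y S - (rho S).@[@epsYhat _ _ _ tgt _ e sig u v sigp eps Y] = 0) &
          (forall k, (f k).@[@epsYhat _ _ _ tgt _ e sig u v sigp eps Y] = 0)]
      <-> exists C, Comp C /\ forall S, Y S = npl ev ar e sig sigp sigpp C S).
Proof.
have [CompG _ _] := HComp.
have CompS C : Comp C -> SCHUBERT ev ar e sig u v C.
  by move=> /CompG; exact: (GRASS_SCHUBERT HB).
have rho_npl C x : Comp C -> @coords _ _ _ tgt _ ev ar _ e sig _ sigp C x ->
    forall S, npl ev ar e sig sigp sigpp C S = (rho S).@[x].
  move=> CC Cx S; have [lam lam0 rhoE] := Hrho _ _ (CompG _ CC) Cx.
  (* Since [rho] is 1 at the top index, [lam] is the inverse of the top coordinate, which is the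
     normalizing factor of [npl]. *)
  have := rhoE topN1; rewrite Hrho_top // meval1.
  rewrite /npl Yat_topset rhoE => top1.
  apply: (mulfI lam0); rewrite mulrA; apply: (canLR (mulfK _)).
    by apply: contra_eq_neq top1 => ->; rewrite mulr0 oner_neq0.
  by rewrite mulrAC -top1 mul1r.
have eps2 k l : eps k l * eps k l = 1.
  by case: (Heps k l) => ->; rewrite ?mulrNN mulr1.
have epsYhat_rho x Y : (forall S, Y S = (rho S).@[x]) ->
    @epsYhat _ _ _ tgt _ e sig u v sigp eps Y =1 x.
  move=> YE t; rewrite /epsYhat Yat_Shat YE (Hrho_hat t) //.
  by rewrite mevalZ mevalXU mulrA eps2 mul1r.
have chart C : Comp C -> exists2 x,
    forall k, (f k).@[x] = 0 & forall S, npl ev ar e sig sigp sigpp C S = (rho S).@[x].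
  move=> CC; have [x Cx] := GRASS_coords HA Hsk (CompG _ CC) HB.
  by exists x; [apply/Hf; exists C | apply: rho_npl].
have locus Y : [/\ Yat Y (topset d u v) - 1 = 0,
    (forall S, Y S - (rho S).@[@epsYhat _ _ _ tgt _ e sig u v sigp eps Y] = 0) &
    (forall k, (f k).@[@epsYhat _ _ _ tgt _ e sig u v sigp eps Y] = 0)]
  <-> exists C, Comp C /\ forall S, Y S = npl ev ar e sig sigp sigpp C S.
  (* Given the equations, [Hf] makes [epsYhat eps Y] the coordinates of some [C] in the component;
     the [rho] equations then identify [Y] with its [npl]. *)
  split=> [[_ Yrho /Hf[C [CC Cx]]]|[C [/chart[x fx xE] YE]]].
    exists C; split=> // S; rewrite (rho_npl _ _ CC Cx).
    by apply/eqP; rewrite -subr_eq0 Yrho.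
  have Yrho S : Y S = (rho S).@[x] by rewrite YE xE.
  split=> [|S|k].
  - by rewrite Yat_topset Yrho Hrho_top // meval1 subrr.
  - by rewrite (meval_eq _ (epsYhat_rho _ _ Yrho)) Yrho subrr.
  - by rewrite (meval_eq _ (epsYhat_rho _ _ Yrho)) fx.
split=> // C; split=> [CC|[SC clC]].
  by split; [apply: CompS | move=> g _; apply].
have vanish h := inClosure_npl HB (h := h) CompS SC clC.
(* If the equations hold at [npl C], then [locus] supplies [C'] in the component with the same
   normalized coordinates, and so [C = C']. The [rho] and [f] equations pass from the component to
   [C] by [vanish]. *)
have [|C' [CC' nplE]] := (locus (npl ev ar e sig sigp sigpp C)).1.
  split=> [|S|k].
  - rewrite Yat_topset /npl -Yat_topset.
    by rewrite divff ?subrr // (SCHUBERT_pl_topset HB).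
  - have := vanish ('X_(enum_rank S) - epsYhat_comp v eps (rho S)).
    rewrite mevalB mevalXU enum_rankK epsYhat_compE; apply=> C' CC'.
    rewrite mevalB mevalXU enum_rankK epsYhat_compE.
    by have [|_ + _] := (locus (npl ev ar e sig sigp sigpp C')).2; [exists C' | exact].
  - have := vanish (epsYhat_comp v eps (f k)); rewrite epsYhat_compE.
    apply=> C' CC'; rewrite epsYhat_compE.
    by have [|_ _] := (locus (npl ev ar e sig sigp sigpp C')).2; [exists C' | exact].
by rewrite (SCHUBERT_npl_inj HB SC (CompS _ CC') nplE).
Qed.
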